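(* Let $1\le p\le\infty$ and let $\mu\ne\nu$ be translation-invariant probability measures on $\Omega$. Then $$\lim_{k\to\infty}\frac{Q'_{p,\Lambda_k}(\mu,\nu)}{|\Lambda_k|^{1/p}}=Q_p(\mu,\nu).$$ As a consequence, $Q_p(\mu,\nu)$ does not depend on $p$, i.e. $Q_p(\mu,\nu)=Q_{p'}(\mu,\nu)$ for all $1\le p,p'\le\infty$. Moreover, $Q_p(\mu,\nu)=\bar d(\mu,\nu)$.
   Context: $S$ is a finite set, $d\ge1$, $\Omega=S^{\mathbb{Z}^d}$ with the product topology and Borel $\sigma$-algebra; $\Lambda_n=[-n,n]^d\cap\mathbb{Z}^d$; for finite nonempty $\Lambda\subset\mathbb{Z}^d$, $\Omega_\Lambda=S^\Lambda$ and $\mu_\Lambda$ is the marginal of $\mu$ on $\Omega_\Lambda$. Shifts: $(\tau_i\eta)_j=\eta_{j-i}$; a probability measure on $\Omega$ is translation invariant if it is invariant under all $\tau_i$, $i\in\mathbb{Z}^d$. A probability measure $\Pi$ on $\Omega\times\Omega$ (generic point $(\sigma^{(1)},\sigma^{(2)})$) is jointly translation invariant if it is invariant under $(\sigma^{(1)},\sigma^{(2)})\mapsto(\tau_i\sigma^{(1)},\tau_i\sigma^{(2)})$ for all $i\in\mathbb{Z}^d$. Let $d_i=\mathbf 1_{\{\sigma^{(1)}_i\neq\sigma^{(2)}_i\}}$. Convention: $|\Lambda|^{1/p}=1$ for $p=\infty$. $\mathcal{C}_\Lambda(\mu,\nu)$ is the set of probability measures $\Pi$ on $\Omega\times\Omega$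 whose marginal on $\Omega_\Lambda\times\Omega_\Lambda$ is a coupling of $\mu_\Lambda$ and $\nu_\Lambda$ (has first marginal $\mu_\Lambda$ and second marginal $\nu_\Lambda$). $\mathcal{C}'_\Lambda(\mu,\nu)$ is the set of jointly translation-invariant elements of $\mathcal{C}_\Lambda(\mu,\nu)$. For $1\le p<\infty$, $Q_{p,\Lambda}(\mu,\nu)=\inf_{\Pi\in\mathcal{C}_\Lambda(\mu,\nu)}\big(\sum_{i\in\Lambda}(\int d_i\,d\Pi)^p\big)^{1/p}$ and $Q'_{p,\Lambda}(\mu,\nu)=\inf_{\Pi\in\mathcal{C}'_\Lambda(\mu,\nu)}\big(\sum_{i\in\Lambda}(\int d_i\,d\Pi)^p\big)^{1/p}$; for $p=\infty$ the $\ell^p$-norm is replaced by $\sup_{i\in\Lambda}\int d_i\,d\Pi$ in both definitions. $Q_p(\mu,\nu):=\lim_{n\to\infty}Q_{p,\Lambda_n}(\mu,\nu)/|\Lambda_n|^{1/p}$ (this limit exists for translation-invariant $\mu,\nu$). $\bar d(\mu,\nu)=\inf_\Pi\Pi\{\sigma^{(1)}_0\neq\sigma^{(2)}_0\}$, the infimum being over all jointly translation-invariant probability measures $\Pi$ on $\Omega\times\Omega$ with marginals $\mu$ and $\nu$. *)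

(* Defs.v *)
From HB Require Import structures.
From mathcomp Require Import all_boot all_order all_algebra finmap.
From mathcomp Require Import all_classical all_reals all_analysis.
From mathcomp Require Import zify.

Set Implicit Arguments.
Unset Strict Implicit.
Unset Printing Implicit Defensive.

Import Order.TTheory GRing.Theory Num.Theory.
Import numFieldNormedType.Exports.

Local Open Scope fset_scope.
Local Open Scope classical_set_scope.
Local Open Scope ring_scope.

(* A measurableType is pointed, so the finite spin set comes with a base point.
   No definition below looks at it, and S is nonempty anyway as soon as there
   is a probability measure on its configurations. *)
#[short(type="pfinType")]
HB.structure Definition PointedFinite := {T of Finite T & Pointed T}.

Notation site d := {ffun 'I_d -> int}.

(* S^I with the Borel sigma-algebra of the product of discrete topologies. *)
Notation config I S :=
  (g_sigma_algebraType (@open (prod_topology (fun _ : I => discrete_topology S)))).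

Definition box (d n : nat) : {fset site d} :=
  [fset ([ffun i => (f i : nat)%:Z - n%:Z] : site d)
    | f : {ffun 'I_d -> 'I_(n.*2.+1)} in predT].

Lemma in_box (d n : nat) (x : site d) :
  (x \in box d n) = [forall i, `|x i| <= n%:Z].
Proof.
apply/imfsetP/forallP => /= [[f _ ->] i|xn].
  by have := ltn_ord (f i); rewrite ffunE ler_norml; lia.
have ltx i : (absz (x i + n%:Z)%R < n.*2.+1)%N.
  by have := xn i; rewrite ler_norml; lia.
exists [ffun i => Ordinal (ltx i)] => //; apply/ffunP => i.
by have := xn i; rewrite !ffunE /= ler_norml; lia.
Qed.

Section Defs.
Context {R : realType} {S : pfinType} {d : nat}.
Local Notation Zd := (site d).
Local Notation Omega := (config Zd S).
Local Notation Joint := (probability (Omega * Omega)%type R).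
Implicit Types (mu nu : probability Omega R).
Implicit Types (Pi : Joint).
Implicit Types (p : \bar R) (L : {fset Zd}).

Definition translate (i : Zd) (eta : Omega) : Omega := fun j => eta (j - i).

Definition translation_invariant mu : Prop :=
  forall (i : Zd) (A : set Omega), measurable A ->
    pushforward mu (translate i) A = mu A.

Definition jointly_translation_invariant Pi : Prop :=
  forall (i : Zd) (A : set (Omega * Omega)), measurable A ->
    pushforward Pi (fun s => (translate i s.1, translate i s.2)) A = Pi A.

Definition restrict_config L (eta : Omega) : config L S := fun i => eta (val i).
Arguments restrict_config L eta : clear implicits.

Definition marginal L mu : set (config L S) -> \bar R :=
  pushforward mu (restrict_config L).
Arguments marginal L mu : clear implicits.

Definition marginal2 L Pi : set (config L S * config L S) -> \bar R :=
  pushforward Pi (fun s => (restrict_config L s.1, restrict_config L s.2)).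
Arguments marginal2 L Pi : clear implicits.

Definition is_coupling (d' : measure_display) (T : measurableType d')
    (P : set (T * T) -> \bar R) (m1 m2 : set T -> \bar R) : Prop :=
  forall A : set T, measurable A ->
    pushforward P fst A = m1 A /\ pushforward P snd A = m2 A.

Definition couplings L mu nu : set Joint :=
  [set Pi : Joint | is_coupling (marginal2 L Pi) (marginal L mu) (marginal L nu)].

Definition ti_couplings L mu nu : set Joint :=
  [set Pi : Joint | couplings L mu nu Pi /\ jointly_translation_invariant Pi].

Definition disagree (i : Zd) : set (Omega * Omega) := [set s | s.1 i != s.2 i].

Definition mean_disagree Pi (i : Zd) : R := \int[Pi]_s \1_(disagree i) s.

(* The exponent p ranges over [1, +oo]; the value at -oo is irrelevant. *)
Definition lp_norm p L (a : Zd -> R) : R :=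
  match p with
  | r%:E => (\sum_(i <- L) a i `^ r) `^ r^-1
  | +oo%E => sup [set a i | i in [set` L]]
  | -oo%E => 0
  end.

Definition card_root p L : R :=
  match p with
  | r%:E => (#|` L|)%:R `^ r^-1
  | _ => 1
  end.

(* couplings contains the product of mu and nu, and so do ti_couplings and
   joinings when mu and nu are translation invariant: inf is each time taken
   over a nonempty set of nonnegative reals. *)
Definition Qfin p L mu nu : R :=
  inf [set lp_norm p L (mean_disagree Pi) | Pi in couplings L mu nu].

Definition Qfin' p L mu nu : R :=
  inf [set lp_norm p L (mean_disagree Pi) | Pi in ti_couplings L mu nu].

(* The limit exists when mu and nu are translation invariant. *)
Definition Q p mu nu : R :=
  limn (fun n => Qfin p (box d n) mu nu / card_root p (box d n)).

Definition joinings mu nu : set Joint :=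
  [set Pi : Joint | is_coupling Pi mu nu /\ jointly_translation_invariant Pi].

Definition dbar mu nu : R :=
  inf [set fine (Pi (disagree 0)) | Pi in joinings mu nu].

End Defs.

Arguments restrict_config {S d} L eta.
Arguments marginal {R S d} L mu.
Arguments marginal2 {R S d} L Pi.

(* Main.v *)
Require Import Defs.
From HB Require Import structures.
From mathcomp Require Import all_boot all_order all_algebra finmap.
From mathcomp Require Import all_classical all_reals all_analysis.
From mathcomp Require Import zify.
Import Order.TTheory GRing.Theory Num.Theory.
Import numFieldNormedType.Exports.

(** All the normalised quantities are squeezed between [1/|box| * sum of the
    mean disagreements], minimised over couplings in the box, and [dbar]: power
    means increase with the exponent, and a jointly invariant measure has a
    constant profile of mean disagreements, for which the normalised l^p norm
    is the constant itself. It remains to see that the l^1 averages are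
    asymptotically at least [dbar]. Average a sequence of couplings in growing
    boxes over the translations of the box, and take the limit along an
    ultrafilter of the mass of every cylinder. By compactness this finitely
    additive limit is a premeasure, and it extends to a probability measure.
    As boxes are Folner sets, the extension is jointly invariant and has
    marginals mu and nu; it disagrees at the origin with probability the limit
    of the averages. *)

Set Implicit Arguments.
Unset Strict Implicit.
Unset Printing Implicit Defensive.

Local Open Scope classical_set_scope.
Local Open Scope ring_scope.

(** * Cylinders of one configuration and the Borel sigma-algebra they generate *)

Section cylinders.
Context {I : countType} {S : pfinType}.
Local Notation T := (config I S).
Local Notation Tprod := (prod_topology (fun _ : I => discrete_topology S)).

Definition agree (L : {fset I}) (s t : T) : Prop :=
  forall j, j \in L -> s j = t j.

Definition cylinder (A : set T) : Prop :=
  exists L, forall s t, agree L s t -> A s -> A t.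

Lemma nbhs_agree (s : Tprod) L :
  nbhs s [set t | agree L s t].
Proof.
have Fs := nbhs_filter s.
have : nbhs s [set t | forall j : L, t (val j) = s (val j)].
  apply: (@filter_forall _ L (fun j => [set t | t (val j) = s (val j)])
    (nbhs s)) => j.
  suff : nbhs (s (val j) : discrete_topology S) [set s (val j)].
    exact: (@proj_continuous I (fun _ => discrete_topology S) (val j) s).
  by rewrite nbhs_principalE; apply/principal_filterP.
apply: filterS => t ts j jL; exact/esym/(ts [` jL]%fset).
Qed.

(** The sets of configurations agreeing with [s] on a finite set generate a filter. It converges to
    [s] in each coordinate, hence in the product topology, so it contains every open set around
    [s]. *)
Lemma open_agree (A : set Tprod) s :
  open A -> A s -> exists L, [set t | agree L s t] `<=` A.
Proof.
move=> oA As.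
pose F := filter_from [set: {fset I}] (fun L => [set t : T | agree L s t]).
have FF : Filter F.
  apply: filter_from_filter; first by exists fset0.
  move=> L1 L2 _ _; exists (L1 `|` L2)%fset => // t st; split=> j jL;
    by apply: st; rewrite inE jL ?orbT.
suff /(_ A) : F --> s.
  by move=> /(_ (open_nbhs_nbhs (conj oA As))) [L _ LA]; exists L.
apply/cvg_sup => j; apply/cvg_image => //.
  apply/seteqP; split=> // v _; exists (fun=> v) => //.
move=> B; rewrite nbhs_principalE => /principal_filterP Bsj.
exists [set t | B (t j)].
  exists [fset j]%fset => // t st /=.
  by rewrite -st ?inE.
apply/seteqP; split=> [_ [t Bt <-] //|v Bv]; exists (fun=> v) => //.
Qed.

Lemma cylinder_measurable A : cylinder A -> measurable A.
Proof.
move=> [L LA]; apply: sub_sigma_algebra; rewrite openE => s As.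
apply: (@filterS _ _ (nbhs_filter s)) (nbhs_agree s L) => t st; exact: LA st As.
Qed.

Definition cylinder_interior L (A : set T) : set T :=
  [set s | [set t | agree L s t] `<=` A].

Lemma agree_sym L s t : agree L s t -> agree L t s.
Proof. by move=> st j /st. Qed.

Lemma agree_trans L t s u : agree L s t -> agree L t u -> agree L s u.
Proof. by move=> st tu j jL; rewrite st// tu. Qed.

Lemma cylinder_interior_cylinder L A : cylinder (cylinder_interior L A).
Proof.
exists L => s t st sA u tu; apply: sA; exact: agree_trans st tu.
Qed.

Lemma open_bigcup_cylinder
    (A : set Tprod) :
  open A -> A = \bigcup_L (cylinder_interior L A).
Proof.
move=> oA; apply/seteqP; split=> [s As|s [L _]]; last exact.
by have [L LA] := open_agree oA As; exists L.
Qed.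

(** A countable [I] has only countably many finite subsets, so an open set is a countable union of
    cylinders, namely of its interiors relative to the finite sets [L]. *)
Lemma measurable_cylinderE : @measurable _ T = <<s cylinder >>.
Proof.
apply/seteqP; split.
  apply: smallest_sub; first exact: smallest_sigma_algebra.
  move=> A oA; rewrite (open_bigcup_cylinder oA).
  pose T' := g_sigma_algebraType cylinder.
  apply: (@countable_bigcupT_measurable _ T') => [|L]; first exact: countableP.
  apply: sub_sigma_algebra; exact: cylinder_interior_cylinder.
apply: smallest_sub; first exact: sigma_algebra_measurable.
exact: cylinder_measurable.
Qed.

End cylinders.

(** * Cylinders of pairs of configurations and the product sigma-algebra *)

Section cylinders2.
Context {I : countType} {S : pfinType}.
Local Notation T := (config I S).

Definition agree2 (L : {fset I}) (s t : T * T) : Prop :=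
  agree L s.1 t.1 /\ agree L s.2 t.2.

Definition cylinder2 (A : set (T * T)) : Prop :=
  exists L, forall s t, agree2 L s t -> A s -> A t.

Lemma agreeS (L M : {fset I}) (s t : T) :
  (L `<=` M)%fset -> agree M s t -> agree L s t.
Proof. by move=> /fsubsetP LM st j /LM; exact: st. Qed.

Lemma agree2S (L M : {fset I}) (s t : T * T) :
  (L `<=` M)%fset -> agree2 M s t -> agree2 L s t.
Proof. by move=> LM [? ?]; split; exact: agreeS LM _. Qed.

Lemma agree2_sym L s t : agree2 L s t -> agree2 L t s.
Proof. by case=> ? ?; split; exact: agree_sym. Qed.

Lemma cylinderI : setI_closed (@cylinder I S).
Proof.
move=> A B [L LA] [M MB]; exists (L `|` M)%fset => s t st [As Bs]; split.
  by apply: LA As; exact: agreeS (fsubsetUl _ _) st.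
by apply: MB Bs; exact: agreeS (fsubsetUr _ _) st.
Qed.

Lemma cylinderC : setC_closed (@cylinder I S).
Proof.
move=> A [L LA]; exists L => s t st As At; apply: As.
by apply: LA At; exact: agree_sym.
Qed.

Lemma cylinder2_0 : cylinder2 set0.
Proof. by exists fset0. Qed.

Lemma cylinder2_U : setU_closed cylinder2.
Proof.
move=> A B [L LA] [M MB]; exists (L `|` M)%fset => s t st [As|Bs].
  by left; apply: LA As; exact: agree2S (fsubsetUl _ _) st.
by right; apply: MB Bs; exact: agree2S (fsubsetUr _ _) st.
Qed.

Lemma cylinder2_C : setC_closed cylinder2.
Proof.
move=> A [L LA]; exists L => s t st As At; apply: As.
by apply: LA At; exact: agree2_sym.
Qed.

Lemma cylinder2_I : setI_closed cylinder2.
Proof.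
move=> A B cA cB; rewrite -[A]setCK -[B]setCK -setCU.
by apply/cylinder2_C/cylinder2_U; exact: cylinder2_C.
Qed.

Lemma cylinder2_fst A : cylinder A -> cylinder2 (fst @^-1` A).
Proof. by move=> [L LA]; exists L => s t [st _]; exact: LA. Qed.

Lemma cylinder2_snd A : cylinder A -> cylinder2 (snd @^-1` A).
Proof. by move=> [L LA]; exists L => s t [_ st]; exact: LA. Qed.

(** Pairs carry the product sigma-algebra, so rectangles are needed: [A] is a finite union of them,
    one for each pattern [w] of the first component on [L]. *)
Lemma cylinder2_measurable A : cylinder2 A -> measurable A.
Proof.
move=> [L LA].
(* The pattern is filled with [point] outside [L], where [A] does not look. *)
pose F (w : {ffun L -> S}) : T := fun i =>
  if insub i is Some j then w j else point.
have FE w (j : L) : F w (val j) = w j by rewrite /F valK.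
pose B w := [set s : T | agree L (F w) s].
pose C w := [set t : T | A (F w, t)].
suff -> : A = \bigcup_w (B w `*` C w).
  apply: countable_bigcupT_measurable => [|w]; first exact: countableP.
  apply: measurableX; apply: cylinder_measurable; exists L => s t st.
    by move=> ws; exact: agree_trans ws st.
  by rewrite /C /=; apply: LA; split.
apply/seteqP; split=> [[s t] Ast|[s t] [w _ [/= ws Cwt]]].
  have ws : agree L (F [ffun j : L => s (val j)]) s.
    by move=> j jL; rewrite (FE _ [` jL]%fset) ffunE.
  exists [ffun j : L => s (val j)] => //; split=> //=.
  by apply: LA Ast; split=> //=; exact: agree_sym.
by apply: LA Cwt; split.
Qed.

(** Both projections are measurable for the sigma-algebra generated by the cylinders, hence so is
    the identity into the product. *)
Lemma measurable_cylinder2E : @measurable _ (T * T)%type = <<s cylinder2 >>.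
Proof.
apply/seteqP; split.
  pose TT' := g_sigma_algebraType (@cylinder2).
  have mfst : measurable_fun setT (fst : TT' -> T).
    apply: (measurability cylinder (@measurable_cylinderE I S)) => _ [A cA <-].
    by rewrite setTI; apply: sub_sigma_algebra; exact: cylinder2_fst.
  have msnd : measurable_fun setT (snd : TT' -> T).
    apply: (measurability cylinder (@measurable_cylinderE I S)) => _ [A cA <-].
    by rewrite setTI; apply: sub_sigma_algebra; exact: cylinder2_snd.
  have mid : measurable_fun setT (fun s : TT' => (s.1, s.2)).
    exact: measurable_fun_pair.
  move=> A mA; have := mid measurableT A mA; rewrite setTI.
  by congr <<s _ >>; apply/seteqP; split=> -[].
apply: smallest_sub; first exact: sigma_algebra_measurable.
exact: cylinder2_measurable.
Qed.

End cylinders2.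

(** * Limits of configurations along an ultrafilter, and compactness *)

Lemma ultra_finite_limit (T : Type) (S : finType) (U : set_system T)
    (u : T -> S) : UltraFilter U -> exists v, U [set n | u n = v].
Proof.
move=> UU; apply: contrapT => /forallNP nU.
have /filter_ex [n] : U [set n | forall v, u n <> v].
  apply: (@filter_forall _ S (fun v => [set n | u n <> v]) U) => v.
  by have [/nU|] := in_ultra_setVsetC [set n | u n = v] UU.
by move=> /(_ (u n)).
Qed.

Section compactness.
Context {I : countType} {S : pfinType}.
Local Notation T := (config I S).

Lemma ultra_config_limit (U : set_system nat) (u : nat -> T) :
  UltraFilter U -> exists s, forall L, U [set n | agree L s (u n)].
Proof.
move=> UU; have lim j := ultra_finite_limit (fun n => u n j) UU.
exists (fun j => projT1 (cid (lim j))) => L.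
have : U [set n | forall j : L, u n (val j) = projT1 (cid (lim (val j)))].
  apply: (@filter_forall _ L
    (fun j => [set n | u n (val j) = projT1 (cid (lim (val j)))]) U) => j.
  by case: cid.
by apply: filterS => n un j jL; rewrite (un [` jL]%fset).
Qed.

(** Otherwise some [s N] in [C] avoids the first [N] sets, for each [N]. The limit of [s] along an
    ultrafilter finer than [\oo] lies in [C], as [C] looks at finitely many sites, hence in some
    [F m]; for the same reason [F m] contains [s k] for some [k] above [m]. *)
Lemma cylinder2_compact (C : set (T * T)) (F : nat -> set (T * T)) :
  cylinder2 C -> (forall n, cylinder2 (F n)) -> C `<=` \bigcup_n F n ->
  exists N, C `<=` \bigcup_(n in `I_N) F n.
Proof.
move=> [L LC] cF CF; apply: contrapT => /forallNP noN.
have {noN} /choice[s sP] N : exists s, C s /\ forall n, (n < N)%N -> ~ F n s.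
  have /existsNP[s /not_implyP[Cs nFs]] := noN N.
  by exists s; split=> // n nN Fs; apply: nFs; exists n.
have [U [UU ooU]] := ultraFilterLemma (@eventually_filter).
have [t1 st1] := ultra_config_limit (fun n => (s n).1) UU.
have [t2 st2] := ultra_config_limit (fun n => (s n).2) UU.
have st M : U [set n | agree2 M (t1, t2) (s n)].
  by apply: filterS (filterI (st1 M) (st2 M)) => n [].
have [n tsn] := filter_ex (st L).
have [m _ Fm] : (\bigcup_n F n) (t1, t2).
  by apply/CF/(LC (s n)); [exact: agree2_sym|exact: (sP n).1].
have [M MF] := cF m.
have /filter_ex [k /= [tsk mk]] :
    U [set k | agree2 M (t1, t2) (s k) /\ (m < k)%N].
  by apply: filterI (st M) _; apply: ooU; exact: nbhs_infty_gt.
exact: (sP k).2 m mk (MF _ _ tsk Fm).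
Qed.

End compactness.

(* An alias, so that the extension theorem sees only the algebra of cylinders
   and not the product sigma-algebra already attached to the pairs. *)
Definition cylinder_space (I : countType) (S : pfinType) : Type :=
  (config I S * config I S)%type.

Fact cylinder_display : measure_display.
Proof. exact: default_measure_display. Qed.

HB.instance Definition _ (I : countType) (S : pfinType) :=
  Pointed.on (cylinder_space I S).

HB.instance Definition _ (I : countType) (S : pfinType) :=
  @isAlgebraOfSets.Build cylinder_display (cylinder_space I S)
    (@cylinder2 I S) (@cylinder2_0 I S) (@cylinder2_U I S) (@cylinder2_C I S).

(** * From a finitely additive mass on cylinders to a probability measure *)

Section extension.
Context {R : realType} {I : countType} {S : pfinType}.
Local Notation T := (config I S).
Variable l : set (T * T) -> R.
Hypothesis l_ge0 : forall A, 0 <= l A.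
Hypothesis lU : forall A B, cylinder2 A -> cylinder2 B ->
  A `&` B = set0 -> l (A `|` B) = l A + l B.
Hypothesis lT : l setT = 1.

Let m (A : set (cylinder_space I S)) : \bar R := (l A)%:E.

Let l0 : l set0 = 0.
Proof.
have := lU cylinder2_0 cylinder2_0 (setI0 _); rewrite setU0 => /eqP.
by rewrite -subr_eq0 opprD addNKr oppr_eq0 => /eqP.
Qed.

Let m0 : m set0 = 0%E. Proof. by rewrite /m l0. Qed.

Let m_ge0 A : (0 <= m A)%E. Proof. by rewrite lee_fin. Qed.

Let m_bigsetU (F : nat -> set (cylinder_space I S)) n :
  (forall i, cylinder2 (F i)) -> trivIset setT F ->
  (\sum_(0 <= i < n) m (F i))%E = m (\big[setU/set0]_(i < n) F i).
Proof.
move=> cF tF; elim: n => [|n IH]; first by rewrite big_nil big_ord0 m0.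
rewrite big_nat_recr//= IH big_ord_recr /= /m -EFinD lU//.
- by elim/big_ind : _ => //; [exact: cylinder2_0|exact: cylinder2_U].
- rewrite big_distrl /= big1// => i _.
  have := tF i n Logic.I Logic.I; apply: contraPP => /eqP/set0P.
  by move=> Fin /(_ Fin) /eqP; rewrite ltn_eqF.
Qed.

(** By compactness, finitely many terms of a disjoint union of cylinders already fill it when it is
    itself a cylinder, so the partial sums are eventually constant. *)
Let m_semi_sigma_additive : semi_sigma_additive m.
Proof.
move=> F cF tF cUF.
have [N FN] := cylinder2_compact cUF cF (@subset_refl _ _).
apply: cvg_near_cst; exists N => // n /= Nn.
rewrite m_bigsetU//; congr m; rewrite -bigcup_mkord.
apply/seteqP; split=> [s [i _ Fis]|]; first by exists i.
apply: subset_trans FN _ => s [i /= iN Fis]; exists i => //=.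
exact: leq_trans iN Nn.
Qed.

HB.instance Definition _ :=
  isMeasure.Build _ _ _ m m0 m_ge0 m_semi_sigma_additive.

Let P : set (T * T) -> \bar R := measure_extension m.

Let P0 : P set0 = 0%E. Proof. exact: (measure0 (measure_extension m)). Qed.

Let P_ge0 A : (0 <= P A)%E. Proof. exact: mu_ext_ge0. Qed.

(** The Caratheodory extension is sigma-additive on the sigma-algebra generated by the cylinders,
    which is the product sigma-algebra of the pairs. *)
Let P_semi_sigma_additive : semi_sigma_additive P.
Proof.
move=> F; rewrite measurable_cylinder2E => mF tF mUF.
exact: (@measure_semi_sigma_additive _ _ _ (measure_extension m)).
Qed.

HB.instance Definition _ :=
  isMeasure.Build _ _ _ P P0 P_ge0 P_semi_sigma_additive.

Let PE C : cylinder2 C -> P C = (l C)%:E.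
Proof. by move=> cC; rewrite /P /measure_extension measurable_mu_extE. Qed.

Let PT : P setT = 1%E.
Proof. by rewrite PE ?lT//; exists fset0. Qed.

HB.instance Definition _ := Measure_isProbability.Build _ _ _ P PT.

Lemma cylinder_extension : exists P : probability (T * T)%type R,
  forall C, cylinder2 C -> P C = (l C)%:E.
Proof. by exists P. Qed.

End extension.

Lemma ultra_unit_cvg (R : realType) (T : Type) (U : set_system T) (u : T -> R) :
  UltraFilter U -> (forall t, 0 <= u t <= 1) ->
  exists2 x, 0 <= x & u @ U --> (x : R).
Proof.
move=> UU u01.
have [|x [/= x01 cx]] := @segment_compact R 0 1 (u @ U) _.
  apply: (@filterS _ U _ setT) filterT => t _.
  by rewrite /= in_itv /=.
exists x; first by move: x01; rewrite in_itv /= => /andP[].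
move=> V Vx; have [//|nV] := in_ultra_setVsetC (u @^-1` V) UU.
by have [y []] := cx (~` V) V nV Vx.
Qed.

(** * Boxes as Folner sets, and sums over them *)

Section box.
Context {d : nat}.

Lemma card_box n : #|` box d n| = (n.*2.+1 ^ d)%N.
Proof.
rewrite card_imfset /=; first by rewrite -cardE card_ffun !card_ord.
move=> f g /ffunP fg; apply/ffunP => i; apply: val_inj.
by have := fg i; rewrite !ffunE => /addIr [].
Qed.

Lemma card_box_gt0 n : (0 < #|` box d n|)%N.
Proof. by rewrite card_box expn_gt0. Qed.

Lemma box_subset m n : (m <= n)%N -> (box d m `<=` box d n)%fset.
Proof.
move=> mn; apply/fsubsetP => i; rewrite !in_box => /forallP im.
by apply/forallP => j; apply: le_trans (im j) _; lia.
Qed.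

Lemma box_add m n i j :
  i \in box d m -> j \in box d n -> i + j \in box d (m + n).
Proof.
rewrite !in_box => /forallP im /forallP jn; apply/forallP => k.
rewrite !ffunE PoszD; apply: le_trans (ler_normD _ _) _.
exact: lerD (im k) (jn k).
Qed.

Lemma fset_subset_box (L : {fset site d}) : exists m, (L `<=` box d m)%fset.
Proof.
(* A crude radius: the sum of the absolute values of all coordinates bounds each of them. *)
exists (\sum_(i <- L) \sum_j `|(i : site d) j|)%N.
apply/fsubsetP => i iL; rewrite in_box; apply/forallP => j.
rewrite -abszE lez_nat (big_fsetD1 i)//= (bigD1 j)//=.
by rewrite -addnA leq_addr.
Qed.

Lemma box_ratio_cvg (R : realType) m :
  (#|` box d (n - m)|%:R / #|` box d n|%:R : R) @[n --> \oo] --> (1 : R).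
Proof.
pose r n : R := (n - m).*2.+1%:R / n.*2.+1%:R.
have -> : (fun n => #|` box d (n - m)|%:R / #|` box d n|%:R) =
    (fun n => r n ^+ d).
  by apply/funext => n; rewrite !card_box /r !natrX expr_div_n.
rewrite -[X in _ --> X](expr1n R d).
suff r1 : r n @[n --> \oo] --> (1 : R).
  apply: (@continuous_cvg _ _ _ _ _ _ (fun x : R => x ^+ d)) r1.
  exact: exprn_continuous.
(* The side ratio is at least [1 - 2m/(2n+1)], also for [n < m] thanks to truncated subtraction, and
   [harmonic n] is [1/(n+1)]. *)
apply: (@squeeze_cvgr _ _ _ _ (fun n => 1 - m.*2%:R * harmonic n) (fun=> 1)).
- apply: nearW => n; rewrite /r ler_pdivrMr ?ltr0n// mul1r ler_nat.
  apply/andP; split; last by lia.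
  rewrite ler_pdivlMr ?ltr0n// mulrBl mul1r lerBlDr.
  apply: (@le_trans _ _ ((n - m).*2.+1 + m.*2)%:R).
    by rewrite ler_nat; lia.
  rewrite natrD lerD2l -mulrA ler_peMr// mulrC ler_pdivlMr ?ltr0n// mul1r.
  by rewrite ler_nat; lia.
- rewrite -[X in _ --> X]subr0 -[X in _ - X](mulr0 (m.*2%:R)).
  apply: cvgB; first exact: cvg_cst.
  by apply: cvgM; [exact: cvg_cst|exact: cvg_harmonic].
- exact: cvg_cst.
Qed.

End box.

Lemma sum_fsetID (R : realType) (I : choiceType) (A B : {fset I}) (f : I -> R) :
  (B `<=` A)%fset ->
  \sum_(i <- A) f i = \sum_(i <- B) f i + \sum_(i <- (A `\` B)%fset) f i.
Proof.
move=> /fsubsetP BA; rewrite (big_fsetID _ (mem B))/=; congr (_ + _).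
  suff -> : [fset x in A | x \in B]%fset = B by [].
  by apply/fsetP => x; rewrite !inE /=; apply: andb_idl; exact: BA.
suff -> : [fset x in A | x \notin B]%fset = (A `\` B)%fset by [].
by apply/fsetP => x; rewrite !inE andbC.
Qed.

Lemma ler_sum_fset (R : realType) (I : choiceType) (A B : {fset I})
    (f : I -> R) :
  (B `<=` A)%fset -> (forall i, 0 <= f i) ->
  \sum_(i <- B) f i <= \sum_(i <- A) f i.
Proof. by move=> BA f0; rewrite (sum_fsetID f BA) lerDl sumr_ge0. Qed.

Lemma sum_fset_le (R : realType) (I : choiceType) (A B : {fset I})
    (f : I -> R) :
  (B `<=` A)%fset -> (forall i, f i <= 1) ->
  \sum_(i <- A) f i <= \sum_(i <- B) f i + (#|` A|%:R - #|` B|%:R).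
Proof.
move=> BA f1; rewrite (sum_fsetID f BA) lerD2l.
rewrite -natrB ?fsubset_leq_card// -cardfsDS// -sum1_size natr_sum.
exact: ler_sum.
Qed.

(** * Measures determined by their values on cylinders *)

Section uniqueness.
Context {R : realType} {I : countType} {S : pfinType}.
Local Notation T := (config I S).

Lemma cylinder_measure_unique (m1 m2 : {measure set T -> \bar R}) :
  (m1 setT < +oo)%E -> (forall A, cylinder A -> m1 A = m2 A) ->
  forall A, measurable A -> m1 A = m2 A.
Proof.
move=> m1oo m12 A mA.
apply: (measure_unique cylinder (fun=> setT)) => //.
- exact: measurable_cylinderE.
- exact: cylinderI.
- by move=> _; exists fset0.
- by rewrite bigcup_const//; exists 0%N.
Qed.

Lemma cylinder2_measure_unique (m1 m2 : {measure set (T * T)%type -> \bar R}) :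
  (m1 setT < +oo)%E -> (forall A, cylinder2 A -> m1 A = m2 A) ->
  forall A, measurable A -> m1 A = m2 A.
Proof.
move=> m1oo m12 A mA.
apply: (measure_unique cylinder2 (fun=> setT)) => //.
- exact: measurable_cylinder2E.
- exact: cylinder2_I.
- by move=> _; exists fset0.
- by rewrite bigcup_const//; exists 0%N.
Qed.

End uniqueness.

(** * Action of the translations on cylinders *)

Section translations.
Context {S : pfinType} {d : nat}.
Local Notation T := (config (site d) S).

Definition translate2 (i : site d) (s : T * T) : T * T :=
  (translate i s.1, translate i s.2).

Lemma agree_translate (L M : {fset site d}) i (s t : T) :
  (forall j, j \in L -> j - i \in M) ->
  agree M s t -> agree L (translate i s) (translate i t).
Proof. by move=> LM st j jL; rewrite /translate st// LM. Qed.

Lemma cylinder_translate i (A : set T) :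
  cylinder A -> cylinder (translate i @^-1` A).
Proof.
move=> [L LA]; exists [fset (j - i)%R | j in L]%fset => s t st; apply: LA.
by apply: agree_translate st => j jL; apply/imfsetP; exists j.
Qed.

Lemma cylinder2_translate2 i (A : set (T * T)) :
  cylinder2 A -> cylinder2 (translate2 i @^-1` A).
Proof.
move=> [L LA]; exists [fset (j - i)%R | j in L]%fset => s t [st1 st2].
apply: LA.
by split; [apply: agree_translate st1|apply: agree_translate st2] => j jL;
  apply/imfsetP; exists j.
Qed.

Lemma measurable_translate2 i : measurable_fun setT (translate2 i).
Proof.
apply: (measurability (@cylinder2 (site d) S) measurable_cylinder2E).
move=> _ [A cA <-]; rewrite setTI.
by apply: cylinder2_measurable; exact: cylinder2_translate2.
Qed.

Lemma translate0 (s : T) : translate 0 s = s.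
Proof. by apply/funext => j; rewrite /translate subr0. Qed.

Lemma translate2_comp i j (A : set (T * T)) :
  translate2 i @^-1` (translate2 j @^-1` A) = translate2 (i + j) @^-1` A.
Proof.
suff h (k : T) : translate j (translate i k) = translate (i + j) k.
  by apply/seteqP; split=> -[s t]; rewrite /translate2 /= !h.
by apply/funext => l; rewrite /translate opprD addrA addrAC.
Qed.

Lemma translate2_disagree i :
  translate2 (- i) @^-1` @disagree S d 0 = disagree i.
Proof.
by apply/seteqP; split=> s; rewrite /disagree /= /translate opprK add0r.
Qed.

Lemma disagree_cylinder2 i : cylinder2 (@disagree S d i).
Proof.
exists [fset i]%fset => s t [st1 st2].
by rewrite /disagree /= st1 ?inE// st2 ?inE.
Qed.

End translations.

(** * Invariance, marginals and couplings tested on cylinders *)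

Section joint.
Context {R : realType} {S : pfinType} {d : nat}.
Local Notation T := (config (site d) S).
Implicit Types (mu nu : probability T R) (Pi : probability (T * T)%type R).

Lemma mean_disagreeE Pi i : mean_disagree Pi i = fine (Pi (disagree i)).
Proof.
rewrite /mean_disagree /Rintegral.
under eq_integral do rewrite /=.
rewrite integral_indic ?setIT//.
by apply: cylinder2_measurable; exact: disagree_cylinder2.
Qed.

Lemma joint_ti_cylinder Pi :
  (forall i C, cylinder2 C -> Pi (translate2 i @^-1` C) = Pi C) ->
  jointly_translation_invariant Pi.
Proof.
move=> PiC i; have mi := @measurable_translate2 S d i.
apply: (@cylinder2_measure_unique _ _ _ (pushforward Pi (translate2 i)) Pi).
  by rewrite /= /pushforward preimage_setT probability_setT ltry.
exact: PiC.
Qed.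

Lemma joint_coupling_cylinder Pi mu nu :
  (forall A, cylinder A -> Pi (fst @^-1` A) = mu A) ->
  (forall A, cylinder A -> Pi (snd @^-1` A) = nu A) ->
  is_coupling Pi mu nu.
Proof.
move=> Pmu Pnu A mA; split.
  have m1 := @measurable_fst _ _ T T.
  apply: (@cylinder_measure_unique _ _ _ (pushforward Pi fst) mu) => //.
  by rewrite /= /pushforward preimage_setT probability_setT ltry.
have m2 := @measurable_snd _ _ T T.
apply: (@cylinder_measure_unique _ _ _ (pushforward Pi snd) nu) => //.
by rewrite /= /pushforward preimage_setT probability_setT ltry.
Qed.

(** Transfers the coupling condition, stated on [config L S], to events of full configurations. The
    witness is the image of [A], measurable because [L] is finite and every subset of [config L S]
    is therefore a cylinder. *)
Lemma determined_preimage_restrict (L : {fset site d}) (A : set T) :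
  (forall s t, agree L s t -> A s -> A t) ->
  exists2 B : set (config L S), measurable B & A = restrict_config L @^-1` B.
Proof.
move=> LA; exists (restrict_config L @` A).
  apply: cylinder_measurable; exists [fset j | j : L]%fset => s t st.
  by suff -> : s = t by []; apply/funext => j; apply: st; rewrite inE.
apply/seteqP; split=> [s As|s [t At ts]]; first by exists s.
by apply: LA At => j jL; exact: (congr1 (fun f => f [` jL]%fset) ts).
Qed.

Lemma coupling_fst L mu nu Pi A : couplings L mu nu Pi ->
  (forall s t, agree L s t -> A s -> A t) -> Pi (fst @^-1` A) = mu A.
Proof. by move=> cPi /determined_preimage_restrict[B /cPi[]] + _ ->. Qed.

Lemma coupling_snd L mu nu Pi A : couplings L mu nu Pi ->
  (forall s t, agree L s t -> A s -> A t) -> Pi (snd @^-1` A) = nu A.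
Proof. by move=> cPi /determined_preimage_restrict[B /cPi[]] _ + ->. Qed.

End joint.

(** The shift by [a] keeps the inner box of radius [n - m] inside the box of radius [n]; each
    remaining site contributes at most 1. *)
Lemma sum_shift_box_le (R : realType) (d m n : nat) (a : site d)
    (f : site d -> R) :
  (m <= n)%N -> a \in box d m -> (forall i, 0 <= f i <= 1) ->
  \sum_(i <- box d n) f (i + a) <=
    \sum_(i <- box d n) f i + (#|` box d n|%:R - #|` box d (n - m)|%:R).
Proof.
move=> mn am f01.
have nmn : (box d (n - m) `<=` box d n)%fset.
  by apply: box_subset; rewrite leq_subr.
apply: le_trans (sum_fset_le (f := fun i => f (i + a)) nmn _) _.
  by move=> i; case/andP: (f01 (i + a)).
rewrite lerD2r.
have -> : \sum_(i <- box d (n - m)) f (i + a) =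
    \sum_(i <- [fset (j + a)%R | j in box d (n - m)]%fset) f i.
  by rewrite [RHS]big_imfset //= => x y _ _ /addIr.
apply: ler_sum_fset; last by move=> i; case/andP: (f01 i).
apply/fsubsetP => _ /imfsetP[j /= jnm ->].
by rewrite -(subnK mn); exact: box_add.
Qed.

(** * Averages of couplings over translations, and their limits *)

Section averages.
Context {R : realType} {S : pfinType} {d : nat}.
Local Notation T := (config (site d) S).
Variables mu nu : probability T R.
Hypotheses (mu_inv : translation_invariant mu)
  (nu_inv : translation_invariant nu).
Variable Pi : nat -> probability (T * T)%type R.
Hypothesis cPi : forall k, couplings (box d k) mu nu (Pi k).

Let N k : R := #|` box d k|%:R.
(** Translating by [- i] brings the site [i] to the origin: this is the mass of the event [A] as
    seen from [i]. *)
Let f k (A : set (T * T)) (i : site d) : R :=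
  fine (Pi k (translate2 (- i) @^-1` A)).

Definition box_average k (A : set (T * T)) : R :=
  (\sum_(i <- box d k) f k A i) / N k.

Let N_gt0 k : 0 < N k. Proof. by rewrite ltr0n card_box_gt0. Qed.

Let N_neq0 k : N k != 0. Proof. by rewrite gt_eqF. Qed.

Let mcyl (A : set (T * T)) (i : site d) :
  cylinder2 A -> measurable (translate2 (- i) @^-1` A).
Proof.
by move=> cA; apply: cylinder2_measurable; exact: cylinder2_translate2.
Qed.

Let f01 k (A : set (T * T)) i : cylinder2 A -> 0 <= f k A i <= 1.
Proof.
move=> cA; rewrite fine_ge0//= -lee_fin fineK ?probability_le1//.
  exact: mcyl.
by apply: fin_num_measure; exact: mcyl.
Qed.

Lemma box_average01 k A : cylinder2 A -> 0 <= box_average k A <= 1.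
Proof.
move=> cA; apply/andP; split.
  apply: divr_ge0; last exact: ltW.
  by apply: sumr_ge0 => i _; have /andP[] := f01 k i cA.
rewrite ler_pdivrMr// mul1r /N -sum1_size natr_sum.
by apply: ler_sum => i _; have /andP[] := f01 k i cA.
Qed.

Lemma box_averageU k A B : cylinder2 A -> cylinder2 B -> A `&` B = set0 ->
  box_average k (A `|` B) = box_average k A + box_average k B.
Proof.
move=> cA cB AB; rewrite -mulrDl -big_split/=; congr (_ / _).
apply: eq_bigr => i _; rewrite /f preimage_setU measureU.
- by rewrite fineD// fin_num_measure//; exact: mcyl.
- exact: mcyl.
- exact: mcyl.
- by rewrite -preimage_setI AB preimage_set0.
Qed.

Lemma box_averageT k : box_average k setT = 1.
Proof.
rewrite /box_average (eq_bigr (fun=> 1)) => [|i _].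
  by rewrite big_const_seq count_predT iter_addr_0; exact: (divff (N_neq0 k)).
by rewrite /f preimage_setT probability_setT.
Qed.

(** The proportion of the box lost by shrinking its radius by [m]; it bounds all boundary effects
    below. *)
Let defect m k : R := 1 - N (k - m) / N k.

Let defect_cvg m : defect m @ \oo --> 0.
Proof.
rewrite -(subrr (1 : R)); apply: cvgB; [exact: cvg_cst|exact: box_ratio_cvg].
Qed.

(** Translating the event by [a] slides the averaging window by [- a], and only boundary sites are
    affected. *)
Lemma box_average_translate A a : cylinder2 A ->
  exists m, \forall k \near \oo,
    box_average k (translate2 a @^-1` A) <= box_average k A + defect m k.
Proof.
move=> cA; have [m /fsubsetP am] := fset_subset_box [fset - a]%fset.
exists m; near=> k.
rewrite /defect /box_average -[X in _ + (X - _)](@divff _ (N k))//.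
rewrite -!mulrBl -mulrDl ler_pM2r ?invr_gt0//.
have shiftf i : f k (translate2 a @^-1` A) i = f k A (i - a).
  by rewrite /f translate2_comp opprB addrC.
rewrite (eq_bigr _ (fun i _ => shiftf i)).
apply: (@sum_shift_box_le R d m k (- a) (f k A)).
- by near: k; exact: nbhs_infty_ge.
- by apply: am; rewrite inE.
- by move=> i; exact: f01.
Unshelve. all: by end_near. Qed.

Let sum_const_le m k A c : (m <= k)%N -> cylinder2 A -> 0 <= c ->
  (forall i, i \in box d (k - m) -> f k A i = c) ->
  box_average k A <= c + defect m k.
Proof.
move=> mk cA c0 fc.
have kmk : (box d (k - m) `<=` box d k)%fset.
  by apply: box_subset; rewrite leq_subr.
rewrite /defect /box_average -[X in _ + (X - _)](@divff _ (N k))//.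
rewrite -mulrBl -[X in X + _](@mulfK _ (N k))//.
rewrite -mulrDl ler_pM2r ?invr_gt0//.
apply: le_trans (sum_fset_le kmk _) _ => [i|].
  by have /andP[] := f01 k i cA.
rewrite lerD2r big_seq (eq_bigr (fun=> c)) => [|i]; last exact: fc.
rewrite -big_seq big_const_seq count_predT iter_addr_0 -mulr_natr ler_wpM2l//.
by rewrite ler_nat fsubset_leq_card.
Qed.

(** If [A] looks at a box of radius [m], then seen from a site of the inner box it depends on the
    box of radius [k] only. There [Pi k] has the first marginal [mu], and invariance of [mu] makes
    the mass that of [A]. *)
Lemma box_average_fst A : cylinder A ->
  exists m, \forall k \near \oo,
    box_average k (fst @^-1` A) <= fine (mu A) + defect m k.
Proof.
move=> cA; have [L LA] := cA; have [m Lm] := fset_subset_box L.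
exists m; near=> k; have mk : (m <= k)%N by near: k; exact: nbhs_infty_ge.
apply: sum_const_le => //; [exact: cylinder2_fst|exact: fine_ge0|move=> i ik].
rewrite /f -(mu_inv (- i)); last exact: cylinder_measurable.
congr fine.
apply: (coupling_fst (A := translate (- i) @^-1` A) (@cPi k)) => s t st.
apply: LA.
apply: agree_translate st => j /(fsubsetP Lm) jm.
by rewrite opprK addrC -(subnK mk); exact: box_add.
Unshelve. all: by end_near. Qed.

Lemma box_average_snd A : cylinder A ->
  exists m, \forall k \near \oo,
    box_average k (snd @^-1` A) <= fine (nu A) + defect m k.
Proof.
move=> cA; have [L LA] := cA; have [m Lm] := fset_subset_box L.
exists m; near=> k; have mk : (m <= k)%N by near: k; exact: nbhs_infty_ge.
apply: sum_const_le => //; [exact: cylinder2_snd|exact: fine_ge0|move=> i ik].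
rewrite /f -(nu_inv (- i)); last exact: cylinder_measurable.
congr fine.
apply: (coupling_snd (A := translate (- i) @^-1` A) (@cPi k)) => s t st.
apply: LA.
apply: agree_translate st => j /(fsubsetP Lm) jm.
by rewrite opprK addrC -(subnK mk); exact: box_add.
Unshelve. all: by end_near. Qed.

Lemma box_average_disagree k :
  box_average k (disagree 0) =
    (\sum_(i <- box d k) mean_disagree (Pi k) i) / N k.
Proof.
congr (_ / _); apply: eq_bigr => i _.
by rewrite /f translate2_disagree mean_disagreeE.
Qed.

(** The filter [F] plays the role of a subsequence: the bound [c] need hold only along it. *)
Lemma joining_of_couplings (F : set_system nat) (c : R) : ProperFilter F ->
  \oo `<=` F ->
  (\forall k \near F,
    (\sum_(i <- box d k) mean_disagree (Pi k) i) / #|` box d k|%:R <= c) ->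
  exists2 P, joinings mu nu P & fine (P (disagree 0)) <= c.
Proof.
move=> PF ooF Fc; have [U [UU FU]] := ultraFilterLemma PF.
have ooU : \oo `<=` U by apply: subset_trans FU.
(* The extension wants a mass that is nonnegative on all sets; off the cylinders it is set to 0. *)
have /choice[l lP] A : exists x : R, 0 <= x /\
    (cylinder2 A -> box_average ^~ A @ U --> x).
  have [cA|ncA] := pselect (cylinder2 A); last by exists 0; split.
  have [x x0 Ux] := ultra_unit_cvg UU (fun k => box_average01 k cA).
  by exists x.
have lcvg A : cylinder2 A -> box_average ^~ A @ U --> l A by exact: (lP A).2.
have [||//|P PE] := @cylinder_extension R (site d) S l.
- by move=> A; exact: (lP A).1.
- move=> A B cA cB AB; apply: (cvg_unique _ (lcvg _ (cylinder2_U cA cB))) => //.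
  rewrite (_ : box_average ^~ _ = fun k => box_average k A + box_average k B).
    by apply: cvgD; exact: lcvg.
  by apply/funext => k; exact: box_averageU.
- apply: (cvg_unique _ (lcvg setT _)) => //; first by exists fset0.
  rewrite (_ : box_average ^~ setT = fun=> 1); first exact: cvg_cst.
  by apply/funext => k; exact: box_averageT.
have l_le A (g : R) m : cylinder2 A ->
    (\forall k \near \oo, box_average k A <= g + defect m k) -> l A <= g.
  move=> cA h; rewrite -[leRHS]addr0.
  apply: (ler_cvg_to (lcvg A cA) _ (ooU _ h)).
  apply: cvgD; first exact: cvg_cst.
  exact: cvg_trans (cvg_app _ ooU) (defect_cvg m).
have PT_le a A : cylinder2 A -> l (translate2 a @^-1` A) <= l A.
  move=> cA; have [m h] := box_average_translate a cA.
  rewrite -[leRHS]addr0.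
  apply: (ler_cvg_to (lcvg _ (cylinder2_translate2 a cA)) _ (ooU _ h)).
  apply: cvgD; first exact: lcvg.
  exact: cvg_trans (cvg_app _ ooU) (defect_cvg m).
(* Upper bounds on a set and on its complement suffice: masses add up to 1. *)
have l_eq (A : set (T * T)) (g : R) : cylinder2 A ->
    l A <= g -> l (~` A) <= 1 - g -> P A = g%:E.
  move=> cA lAg; rewrite PE// => lCg; congr EFin; apply/le_anti; rewrite lAg /=.
  have := probability_setC P (cylinder2_measurable cA).
  rewrite !PE//; last exact: cylinder2_C.
  by case=> lC; move: lCg; rewrite lC lerD2l lerN2.
have fineC (m : probability T R) A :
    cylinder A -> fine (m (~` A)) = 1 - fine (m A).
  move=> /cylinder_measurable mA; rewrite probability_setC// fineB//.
  by rewrite fin_num_measure.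
exists P; [split|].
- apply: joint_coupling_cylinder => A cA.
  + rewrite -[RHS]fineK ?fin_num_measure//; last exact: cylinder_measurable.
    apply: l_eq; first exact: cylinder2_fst.
      by have [m] := box_average_fst cA; apply: l_le; exact: cylinder2_fst.
    rewrite -fineC//; have [m] := box_average_fst (cylinderC cA).
    by apply: l_le; apply: cylinder2_C; exact: cylinder2_fst.
  + rewrite -[RHS]fineK ?fin_num_measure//; last exact: cylinder_measurable.
    apply: l_eq; first exact: cylinder2_snd.
      by have [m] := box_average_snd cA; apply: l_le; exact: cylinder2_snd.
    rewrite -fineC//; have [m] := box_average_snd (cylinderC cA).
    by apply: l_le; apply: cylinder2_C; exact: cylinder2_snd.
- apply: joint_ti_cylinder => i A cA; have ciA := cylinder2_translate2 i cA.
  rewrite !PE//; congr EFin; apply/le_anti; rewrite PT_le//=.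
  (* Translating back by [- i] yields the reverse inequality. *)
  have := PT_le (- i) _ ciA; rewrite translate2_comp addNr.
  suff -> : translate2 0 @^-1` A = A by [].
  by apply/seteqP; split=> -[s t]; rewrite /translate2 /= !translate0.
- have cdis := @disagree_cylinder2 S d 0.
  rewrite PE//=; apply: (cvgr_to_le (lcvg _ cdis)); apply: FU.
  by apply: filterS Fc => k; rewrite box_average_disagree.
Qed.

End averages.

(** * Power means and normalised l^p norms *)

Lemma bernoulli_powR (R : realType) (x r : R) : 0 <= x -> 1 <= r ->
  x <= x `^ r / r + (1 - r^-1).
Proof.
move=> x0; rewrite le_eqVlt => /predU1P[<-|r1].
  by rewrite powRr1// invr1 mulr1 subrr addr0.
have r0 : 0 < r by exact: lt_trans r1.
have q0 : 0 < 1 - r^-1 by rewrite subr_gt0 invf_lt1.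
(* Young's inequality for the product [x * 1]; the case [r = 1], whose conjugate exponent is
   infinite, is already settled. *)
have := @conjugate_powR R x 1 r (1 - r^-1)^-1 x0 ler01 r0.
by rewrite invr_gt0 invrK powR1 mulr1 mul1r addrCA subrr addr0; apply.
Qed.

(** Divide by the power mean [M]: the r-th powers of [a i / M] then add up to [size s], and summing
    the Young bound over [s] gives [(1/r + 1 - 1/r) * size s]. *)
Lemma power_mean (R : realType) (I : eqType) (s : seq I) (a : I -> R) (r : R) :
  (0 < size s)%N -> (forall i, 0 <= a i) -> 1 <= r ->
  (\sum_(i <- s) a i) / (size s)%:R <=
    (\sum_(i <- s) a i `^ r) `^ r^-1 / (size s)%:R `^ r^-1.
Proof.
move=> s0 a0 r1; have r0 : 0 < r by exact: lt_le_trans r1.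
have N0 : 0 < (size s)%:R :> R by rewrite ltr0n.
have sr0 : 0 <= \sum_(i <- s) a i `^ r.
  by apply: sumr_ge0 => i _; exact: powR_ge0.
have rr : r^-1 * r = 1 by rewrite mulVf ?gt_eqF.
have powRV (x t : R) : 0 <= x -> x^-1 `^ t = (x `^ t)^-1.
  by move=> x0; rewrite -(powR_inv1 x0) -powRrM mulN1r powRN.
have Msum M : 0 < M -> \sum_(i <- s) a i `^ r = M `^ r * (size s)%:R ->
    \sum_(i <- s) a i <= M * (size s)%:R.
  move=> M0 ME; rewrite -ler_pdivrMl// mulr_sumr.
  apply: (@le_trans _ _ (\sum_(i <- s) ((M^-1 * a i) `^ r / r + (1 - r^-1)))).
    apply: ler_sum => i _; apply: bernoulli_powR => //.
    by rewrite mulr_ge0// invr_ge0 ltW.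
  rewrite big_split/= big_const_seq count_predT iter_addr_0.
  rewrite -mulr_suml (eq_bigr (fun i => (M `^ r)^-1 * a i `^ r)); last first.
    by move=> i _; rewrite powRM ?invr_ge0 ?(ltW M0)// powRV// ltW.
  rewrite -mulr_sumr ME mulKf ?gt_eqF ?powR_gt0//.
  rewrite -[(_ - _) *+ _]mulr_natr [_ / r]mulrC -mulrDl addrCA subrr addr0.
  by rewrite mul1r.
set X := \sum_(i <- s) a i `^ r in sr0 Msum *.
(* Here the power mean is 0 and cannot be divided by, but all terms vanish. *)
have [X0|Xn0] := eqVneq X 0.
  rewrite big1_seq ?mul0r ?divr_ge0 ?powR_ge0// => i /andP[_ si].
  move/eqP: X0; rewrite psumr_eq0 => [/allP/(_ i si)/= /eqP|j _]; last first.
    exact: powR_ge0.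
  exact: powR_eq0_eq0.
have Xgt0 : 0 < X by rewrite lt_def Xn0.
rewrite ler_pdivrMr//; apply: Msum; first by rewrite divr_gt0// powR_gt0.
rewrite powRM ?invr_ge0 ?powR_ge0// powRV ?powR_ge0// -!powRrM rr.
rewrite !powRr1 ?ltW//.
by rewrite divfK// gt_eqF.
Qed.

Section norms.
Context {R : realType} {d : nat}.
Implicit Types (p : \bar R) (L : {fset site d}) (a : site d -> R).

Lemma card_root_gt0 p L : (0 < #|` L|)%N -> 0 < card_root p L.
Proof. by case: p => [r||] // L0; rewrite powR_gt0 ?ltr0n. Qed.

Lemma lp_norm_const p L (c : R) : (1%:E <= p)%E -> (0 < #|` L|)%N -> 0 <= c ->
  lp_norm p L (fun=> c) = c * card_root p L.
Proof.
case: p => [r||]//=; rewrite ?lee_fin => r1 L0 c0.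
  have r0 : r != 0 by rewrite gt_eqF// (lt_le_trans ltr01).
  rewrite big_const_seq count_predT iter_addr_0 -[in LHS]mulr_natr.
  by rewrite powRM ?powR_ge0// -powRrM divff// powRr1.
rewrite mulr1 (_ : [set c | i in _] = [set c]) ?sup1//.
have /fset0Pn[i iL] : L != fset0 by rewrite -cardfs_gt0.
by apply/seteqP; split=> [_ [j _ <-]//|_ ->]; exists i.
Qed.

(** For [p = +oo], the bound of [a] by 1 guarantees that [sup] is a genuine upper bound. *)
Lemma average_le_lp_norm p L a : (1%:E <= p)%E -> (0 < #|` L|)%N ->
  (forall i, 0 <= a i <= 1) ->
  (\sum_(i <- L) a i) / #|` L|%:R <= lp_norm p L a / card_root p L.
Proof.
case: p => [r||]//=; rewrite ?lee_fin => r1 L0 a01.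
  by apply: power_mean => // i; case/andP: (a01 i).
rewrite divr1 ler_pdivrMr ?ltr0n// -[_ * _]addr0 mulr_natr -iter_addr.
rewrite -(count_predT L) -big_const_seq !big_seq; apply: ler_sum => i iL.
apply: ub_le_sup; last by exists i.
by exists 1 => _ [j _ <-]; case/andP: (a01 j).
Qed.
End norms.

(** * Comparison of the finite-volume quantities with [dbar] *)

Section limits.
Context {R : realType} {S : pfinType} {d : nat}.
Local Notation T := (config (site d) S).
Implicit Types (mu nu : probability T R) (Pi : probability (T * T)%type R).
Implicit Types (p : \bar R) (L : {fset site d}).

Lemma mean_disagree01 Pi i : 0 <= mean_disagree Pi i <= 1.
Proof.
have mD : measurable (@disagree S d i).
  by apply: cylinder2_measurable; exact: disagree_cylinder2.
rewrite mean_disagreeE fine_ge0//= -lee_fin fineK ?probability_le1//.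
exact: fin_num_measure.
Qed.

Lemma mean_disagree_ti Pi i : jointly_translation_invariant Pi ->
  mean_disagree Pi i = fine (Pi (disagree 0)).
Proof.
move=> tiPi; rewrite mean_disagreeE -(translate2_disagree i).
rewrite -[in RHS](tiPi (- i))//.
by apply: cylinder2_measurable; exact: disagree_cylinder2.
Qed.

Lemma couplings_joining L mu nu Pi :
  is_coupling Pi mu nu -> couplings L mu nu Pi.
Proof.
move=> cPi B _; apply: cPi; apply: cylinder_measurable; exists L => s t st.
suff est : restrict_config L s = restrict_config L t.
  by rewrite /preimage /= est.
by apply/funext => j; exact: st (valP j).
Qed.

Definition product_joint mu nu : probability (T * T)%type R := (mu \x nu)%E.

Lemma product_coupling mu nu :
  is_coupling (product_joint mu nu) mu nu.
Proof.
move=> A mA; rewrite /pushforward /product_joint; split.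
  rewrite (_ : fst @^-1` A = A `*` setT); last first.
    by apply/seteqP; split=> [? ?|? []].
  by rewrite /= product_measure1E// [X in (_ * X)%E]probability_setT mule1.
rewrite (_ : snd @^-1` A = setT `*` A); last first.
  by apply/seteqP; split=> [? ?|? []].
by rewrite /= product_measure1E// [X in (X * _)%E]probability_setT mul1e.
Qed.

Lemma lp_norm_mean_ge0 p L Pi : (1%:E <= p)%E -> (0 < #|` L|)%N ->
  0 <= lp_norm p L (mean_disagree Pi).
Proof.
move=> p1 L0; have r0 := card_root_gt0 p L0.
rewrite -(@pmulr_lge0 _ (card_root p L)^-1) ?invr_gt0//.
apply: le_trans (average_le_lp_norm p1 L0 (mean_disagree01 Pi)).
apply: divr_ge0 => //; apply: sumr_ge0 => i _.
by case/andP: (mean_disagree01 Pi i).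
Qed.

Lemma Qfin_le p L mu nu Pi : (1%:E <= p)%E -> (0 < #|` L|)%N ->
  couplings L mu nu Pi -> Qfin p L mu nu <= lp_norm p L (mean_disagree Pi).
Proof.
move=> p1 L0 cPi; apply: ge_inf; last by exists Pi.
by exists 0 => _ [Pi' _ <-]; exact: lp_norm_mean_ge0.
Qed.

Lemma Qfin'_le p L mu nu Pi : (1%:E <= p)%E -> (0 < #|` L|)%N ->
  ti_couplings L mu nu Pi -> Qfin' p L mu nu <= lp_norm p L (mean_disagree Pi).
Proof.
move=> p1 L0 cPi; apply: ge_inf; last by exists Pi.
by exists 0 => _ [Pi' _ <-]; exact: lp_norm_mean_ge0.
Qed.

Lemma dbar_le mu nu Pi :
  joinings mu nu Pi -> dbar mu nu <= fine (Pi (disagree 0)).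
Proof.
move=> jPi; apply: ge_inf; last by exists Pi.
by exists 0 => _ [Pi' _ <-]; exact: fine_ge0.
Qed.

Section invariant.
Variables mu nu : probability T R.
Hypotheses (mu_inv : translation_invariant mu)
  (nu_inv : translation_invariant nu).

(** The product measure is a coupling in every box, with averages trivially at most 1; invariance is
    supplied by the averaging construction. *)
Lemma joinings_nonempty : joinings mu nu !=set0.
Proof.
have [k|||P jP _] := @joining_of_couplings R S d mu nu mu_inv nu_inv
  (fun=> (product_joint mu nu)) _ \oo 1 _ _ _.
- by apply: couplings_joining; exact: product_coupling.
- by [].
- apply: nearW => k; rewrite ler_pdivrMr ?ltr0n ?card_box_gt0// mul1r.
  rewrite -sum1_size natr_sum; apply: ler_sum => i _.
  by case/andP: (mean_disagree01 (product_joint mu nu) i).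
- by exists P.
Qed.

(** Otherwise the set [B] of boxes admitting a coupling with average at most [dbar mu nu - e] is
    infinite. A limit along [B] is a joining that disagrees at the origin with probability below
    [dbar], which is absurd. *)
Lemma dbar_average_near e : 0 < e -> \forall k \near \oo,
  forall Pi, couplings (box d k) mu nu Pi ->
    dbar mu nu - e <=
      (\sum_(i <- box d k) mean_disagree Pi i) / #|` box d k|%:R.
Proof.
move=> e0; apply: contrapT.
pose avg k (Pi : probability (T * T)%type R) : R :=
  (\sum_(i <- box d k) mean_disagree Pi i) / #|` box d k|%:R.
pose B := [set k | exists2 Pi, couplings (box d k) mu nu Pi &
  avg k Pi <= dbar mu nu - e].
move=> nB.
have PF : ProperFilter (within B \oo).
  apply: Build_ProperFilter_ex.
  move=> A BA; apply: contrapT => /forallNP nA; apply: nB.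
  move: BA; rewrite /within /=; apply: filterS => k kA Pi cPi.
  rewrite leNgt; apply/negP => lt.
  by apply: (nA k); apply: kA; exists Pi => //; exact: ltW.
have /choice[Pi PiP] k : exists Pi, couplings (box d k) mu nu Pi /\
    (B k -> avg k Pi <= dbar mu nu - e).
  have [[Pi cPi aPi]|nBk] := pselect (B k); first by exists Pi.
  (* Off [B] any coupling will do. *)
  exists (product_joint mu nu); split => //.
  by apply: couplings_joining; exact: product_coupling.
have [||P jP] := @joining_of_couplings R S d mu nu mu_inv nu_inv Pi
  (fun k => (PiP k).1) (within B \oo) (dbar mu nu - e) PF.
- exact: cvg_within.
- by apply: (filterS _ (withinT B _)) => k; exact: (PiP k).2.
- apply/negP; rewrite -ltNge; apply: lt_le_trans (dbar_le jP).
  by rewrite ltrBlDr ltrDl.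
Qed.

Lemma Qfin_le_Qfin' p k : (1%:E <= p)%E ->
  Qfin p (box d k) mu nu <= Qfin' p (box d k) mu nu.
Proof.
move=> p1; have [P [cP tP]] := joinings_nonempty.
apply: lb_le_inf.
  exists (lp_norm p (box d k) (mean_disagree P)), P => //.
  by split=> //; exact: couplings_joining.
by move=> _ [Pi [cPi _] <-]; apply: Qfin_le => //; exact: card_box_gt0.
Qed.

Lemma Qfin'_le_dbar p k : (1%:E <= p)%E ->
  Qfin' p (box d k) mu nu / card_root p (box d k) <= dbar mu nu.
Proof.
move=> p1; have L0 := @card_box_gt0 d k; have [P jP] := joinings_nonempty.
apply: lb_le_inf; first by exists (fine (P (disagree 0))), P.
move=> _ [Pi [cPi tPi] <-]; rewrite ler_pdivrMr ?card_root_gt0//.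
rewrite -lp_norm_const ?fine_ge0//.
rewrite -(_ : mean_disagree Pi = fun=> _); last first.
  by apply/funext => i; exact: mean_disagree_ti.
by apply: Qfin'_le => //; split=> //; exact: couplings_joining.
Qed.

Lemma dbar_le_Qfin_near p e : (1%:E <= p)%E -> 0 < e -> \forall k \near \oo,
  dbar mu nu - e <= Qfin p (box d k) mu nu / card_root p (box d k).
Proof.
move=> p1 e0; apply: filterS (dbar_average_near e0) => k kP.
have L0 := @card_box_gt0 d k; have r0 := card_root_gt0 p L0.
rewrite ler_pdivlMr//; apply: lb_le_inf.
  exists (lp_norm p (box d k) (mean_disagree (product_joint mu nu))).
  exists (product_joint mu nu) => //.
  by apply: couplings_joining; exact: product_coupling.
move=> _ [Pi cPi <-]; rewrite -ler_pdivlMr//; apply: le_trans (kP _ cPi) _.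
by apply: average_le_lp_norm => // i; exact: mean_disagree01.
Qed.

(** The upper bound holds for every [k], the lower one up to [e] for large [k]; this also shows that
    the limit defining [Q] exists. *)
Lemma Qfin_cvg_dbar p : (1%:E <= p)%E ->
  Qfin p (box d k) mu nu / card_root p (box d k) @[k --> \oo] --> dbar mu nu.
Proof.
move=> p1; apply/cvgrPdist_le => e e0; near=> k.
have QQ : Qfin p (box d k) mu nu / card_root p (box d k) <= dbar mu nu.
  apply: le_trans (Qfin'_le_dbar k p1).
  by rewrite ler_pM2r ?invr_gt0 ?card_root_gt0 ?card_box_gt0// Qfin_le_Qfin'.
rewrite ger0_norm ?subr_ge0// lerBlDr addrC -lerBlDr.
by near: k; exact: dbar_le_Qfin_near.
Unshelve. all: by end_near. Qed.

Lemma Qfin'_cvg_dbar p : (1%:E <= p)%E ->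
  Qfin' p (box d k) mu nu / card_root p (box d k) @[k --> \oo] --> dbar mu nu.
Proof.
move=> p1; apply: (squeeze_cvgr _ (Qfin_cvg_dbar p1) (cvg_cst _)).
apply: nearW => k; rewrite Qfin'_le_dbar// andbT.
by rewrite ler_pM2r ?invr_gt0 ?card_root_gt0 ?card_box_gt0// Qfin_le_Qfin'.
Qed.

Lemma Q_eq_dbar p : (1%:E <= p)%E -> Q p mu nu = dbar mu nu.
Proof. by move=> p1; apply/cvg_lim => //; exact: Qfin_cvg_dbar. Qed.

End invariant.
End limits.

Theorem theorem5p3 (R : realType) (S : pfinType) (d : nat) (d_gt0 : (0 < d)%N)
    (mu nu : probability (config (site d) S) R)
    (mu_neq_nu : ~ (forall A : set (config (site d) S),
                      measurable A -> mu A = nu A))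
    (mu_inv : translation_invariant mu) (nu_inv : translation_invariant nu) :
  (forall p : \bar R, (1%:E <= p)%E ->
     Qfin' p (box d k) mu nu / card_root p (box d k) @[k --> \oo] --> Q p mu nu)
  /\ (forall p p' : \bar R, (1%:E <= p)%E -> (1%:E <= p')%E ->
        Q p mu nu = Q p' mu nu)
  /\ (forall p : \bar R, (1%:E <= p)%E -> Q p mu nu = dbar mu nu).
Proof.
split=> [p p1|]; first by rewrite Q_eq_dbar//; exact: Qfin'_cvg_dbar.
by split=> [p p' p1 p'1|p p1]; rewrite !Q_eq_dbar.
Qed.
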